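(* There is an absolute constant $c>0$ such that the following holds. Let $\mathcal{G}$ be a 2D SLP deriving a 2D string $T \in \Sigma^{N \times M}$ with $N \le M$. Then one can construct a 2D SLP $\mathcal{G}''$ with $\exp(\mathcal{G}'') = T$, of size at most $c\cdot|\mathcal{G}| \cdot N$ and depth at most $c\cdot \log M$ (for $M\ge 2$).
   Context: Let $\Sigma$ be a fixed finite alphabet. A 2D string of size $n\times m$ is an $n\times m$ array of characters of $\Sigma$; $\mathrm{h}(S)=n$ is its height and $\mathrm{w}(S)=m$ its width; $S[i]$ denotes its $i$-th row. For 2D strings $A,B$ with $\mathrm{h}(A)=\mathrm{h}(B)$, $A \oplus_{\mathrm h} B$ denotes their horizontal concatenation ($B$ placed to the right of $A$); for $\mathrm{w}(A)=\mathrm{w}(B)$, $A\oplus_{\mathrm v} B$ denotes their vertical concatenation ($B$ placed below $A$). A 2D SLP is a triple $\mathcal{G}=(\mathcal{V},\mathcal{S},\rho)$ where $\mathcal{V}$ is a finite set of nonterminals (disjoint from $\Sigma$), each $X\in\mathcal V$ having a dimension $(\mathrm h(X),\mathrm w(X))$, $\mathcal S\in\mathcal V$ is the starting nonterminal, and $\rho$ assigns to each $X$ a right-hand side which is either a character $\sigma\in\Sigma$ (then $\mathrm h(X)=\mathrm w(X)=1$), or $Y\oplus_{\mathrm h} Z$ with $Y,Z\in\mathcal V$, $\mathrm h(X)=\mathrm h(Y)=\mathrm h(Z)$, $\mathrm w(X)=\mathrm w(Y)+\mathrm w(Z)$, or $Y\oplus_{\mathrm v}Z$ with $Y,Z\in\mathcal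 V$, $\mathrm w(X)=\mathrm w(Y)=\mathrm w(Z)$, $\mathrm h(X)=\mathrm h(Y)+\mathrm h(Z)$; the relation ''$Y$ occurs in the right-hand side of $X$'' must be acyclic. The expansion $\exp(X)$ is defined recursively ($\exp(\sigma)=\sigma$, $\exp$ commutes with the concatenations), and $\exp(\mathcal G)=\exp(\mathcal S)$ is the string derived by $\mathcal G$. The size $|\mathcal G|$ is the total number of symbols (nonterminals and characters) on all right-hand sides; the depth is the depth of the derivation tree (rooted at $\mathcal S$, each node labeled $X$ having as children the symbols of $\rho(X)$). A 1D SLP is a 2D SLP using only character and horizontal-concatenation productions; it derives a $1\times n$ string, identified with an ordinary string of length $n$. Two SLPs are equivalent if they derive the same string. *)

(* Defs.v *)
From mathcomp Require Import all_boot.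
Set Implicit Arguments. Unset Strict Implicit. Unset Printing Implicit Defensive.

(* A 2D string is a list of rows (each row a list of characters). *)
Definition str2 (S : Type) := seq (seq S).

Definition h2 {S} (T : str2 S) : nat := size T.
Definition w2 {S} (T : str2 S) : nat := size (head [::] T).

Definition hcat {S} (A B : str2 S) : str2 S := map (fun p => p.1 ++ p.2) (zip A B).
Definition vcat {S} (A B : str2 S) : str2 S := A ++ B.

(* Right-hand sides of a 2D SLP. Nonterminals are natural numbers:
   nonterminal k is the k-th rule of the grammar. *)
Inductive rhs (S : Type) :=
| Term of S
| HCat of nat & nat
| VCat of nat & nat.
Arguments Term {S}. Arguments HCat {S}. Arguments VCat {S}.

(* A 2D SLP: list of rules; the starting nonterminal is the last one. *)
Definition slp2 (S : Type) := seq (rhs S).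

Definition eval_rhs {S} (E : seq (str2 S)) (r : rhs S) : str2 S :=
  match r with
  | Term a => [:: [:: a]]
  | HCat i j => hcat (nth [::] E i) (nth [::] E j)
  | VCat i j => vcat (nth [::] E i) (nth [::] E j)
  end.

Definition exps {S} (g : slp2 S) : seq (str2 S) :=
  foldl (fun E r => rcons E (eval_rhs E r)) [::] g.

Definition exp2 {S} (g : slp2 S) : str2 S := last [::] (exps g).

Definition wf_rule {S} (E : seq (str2 S)) (k : nat) (r : rhs S) : bool :=
  match r with
  | Term _ => true
  | HCat i j => [&& i < k, j < k & h2 (nth [::] E i) == h2 (nth [::] E j)]
  | VCat i j => [&& i < k, j < k & w2 (nth [::] E i) == w2 (nth [::] E j)]
  end.

Definition wf_slp2 {S} (g : slp2 S) : bool :=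
  (0 < size g) &&
  all (fun p => wf_rule (exps g) p.1 p.2) (zip (iota 0 (size g)) g).

Definition rhs_size {S} (r : rhs S) : nat :=
  match r with Term _ => 1 | _ => 2 end.
Definition size_slp2 {S} (g : slp2 S) : nat := sumn (map rhs_size g).

(* depth of the derivation tree rooted at each nonterminal
   (number of edges on a longest root-to-leaf path; the leaves are characters) *)
Definition depth_rhs {S} (D : seq nat) (r : rhs S) : nat :=
  match r with
  | Term _ => 1
  | HCat i j | VCat i j => (maxn (nth 0 D i) (nth 0 D j)).+1
  end.
Definition depths {S} (g : slp2 S) : seq nat :=
  foldl (fun D r => rcons D (depth_rhs D r)) [::] g.
Definition depth_slp2 {S} (g : slp2 S) : nat := last 0 (depths g).

(* Main.v *)
Require Import Defs.
From mathcomp Require Import all_boot zify.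
From HB Require Import structures.
Set Implicit Arguments. Unset Strict Implicit. Unset Printing Implicit Defensive.

(* The rows of the nonterminals form a 1D SLP with at most |G| N nonterminals,
   which is balanced as in Ganardi, Jez and Lohrey. A nonterminal is identified
   with its derivation tree, so that an SLP is a set of trees closed under taking
   children, and sharing is equality of trees.
   Give a tree [v] the potential [log |v| - log (number of occurrences of v)],
   with rounded logarithms. It does not increase from parent to child, and the
   edges along which it is constant form vertex-disjoint chains. If the subtrees
   hanging off a chain have already been balanced, then all nodes of the chain
   are obtained from the suffixes of the word of left hanging trees and the
   prefixes of the word of right hanging trees; these can be produced with
   linearly many new nodes and height [6 log |v| + O(1)] on top of a bound of
   the form [B + 6 log |t|] for the hanging trees [t]. So every drop of
   the potential costs [O(1)] in height, and the potential ranges over an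
   interval of length [O(log M)]. *)

(** * Derivation trees *)

Inductive tree (A : Type) := Leaf of A | Node of bool & tree A & tree A.
Arguments Leaf {A}. Arguments Node {A}.

Fixpoint yield A (t : tree A) : seq A :=
  match t with Leaf a => [:: a] | Node _ l r => yield l ++ yield r end.

Fixpoint height A (t : tree A) : nat :=
  match t with Leaf _ => 1 | Node _ l r => (maxn (height l) (height r)).+1 end.

Fixpoint grid A (t : tree A) : str2 A :=
  match t with
  | Leaf a => [:: [:: a]]
  | Node false l r => hcat (grid l) (grid r)
  | Node true l r => vcat (grid l) (grid r)
  end.

Section TreeEq.
Variable A : eqType.

Fixpoint eq_tree (t u : tree A) : bool :=
  match t, u with
  | Leaf a, Leaf b => a == b
  | Node b l r, Node b' l' r' => [&& b == b', eq_tree l l' & eq_tree r r']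
  | _, _ => false
  end.

Lemma eq_treeP : Equality.axiom eq_tree.
Proof.
elim=> [a|b l IHl r IHr] [a'|b' l' r'] /=; try by constructor.
  by apply: (iffP eqP) => [->|[]].
apply: (iffP and3P) => [[/eqP-> /IHl-> /IHr->] // | [-> <- <-]].
by split; [|exact/IHl|exact/IHr].
Qed.

HB.instance Definition _ := hasDecEq.Build (tree A) eq_treeP.
End TreeEq.

(** * Trees obtainable from a base set with few new nodes *)

Section Derives.
Variables (A : eqType) (b : bool).
Implicit Types (E X Y base : seq (tree A)).

(** No order on [E] is demanded: children are smaller trees, so acyclicity comes for free. *)
Definition builds E base := forall t, t \in E ->
  exists l r, [/\ t = Node b l r, l \in E ++ base & r \in E ++ base].

Definition derives base n X := exists E,
  [/\ size E <= n, builds E base & {subset X <= E ++ base}].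

Lemma derives_base base n X : {subset X <= base} -> derives base n X.
Proof. by move=> sub; exists [::]; split. Qed.

Lemma derives_sub base base' n m X Y : derives base n X -> n <= m ->
  {subset base <= base'} -> {subset Y <= X ++ base'} -> derives base' m Y.
Proof.
move=> [E [sE bE sX]] nm sb sY; exists E; split.
- exact: leq_trans nm.
- have w t : t \in E ++ base -> t \in E ++ base'.
    by rewrite !mem_cat => /orP[->//|/sb ->]; rewrite orbT.
  move=> t /bE[l [r [-> lE rE]]]; exists l, r; split=> //; exact: w.
- move=> t /sY; rewrite !mem_cat => /orP[/sX|->]; last by rewrite orbT.
  by rewrite mem_cat => /orP[->//|/sb ->]; rewrite orbT.
Qed.

Lemma derives_trans base n m X Y : derives base n X -> derives (X ++ base) m Y ->
  derives base (n + m) (X ++ Y).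
Proof.
move=> [E [sE bE sX]] [F [sF bF sY]].
have w t : t \in F ++ X ++ base -> t \in (F ++ E) ++ base.
  rewrite !mem_cat => /or3P[->//|/sX|->]; last by rewrite !orbT.
  by rewrite mem_cat => /orP[->|->]; rewrite !orbT.
exists (F ++ E); split.
- by rewrite size_cat addnC leq_add.
- move=> t; rewrite mem_cat => /orP[/bF|/bE] [l [r [-> lE rE]]]; exists l, r;
    split=> //; try exact: w.
    by rewrite -catA mem_cat lE orbT.
  by rewrite -catA mem_cat rE orbT.
- move=> t; rewrite mem_cat => /orP[/sX tE|/sY]; last exact: w.
  by rewrite -catA mem_cat tE orbT.
Qed.

Lemma derives_node base l r : l \in base -> r \in base ->
  derives base 1 [:: Node b l r].
Proof.
move=> lb rb; exists [:: Node b l r]; split=> //.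
- move=> t; rewrite inE => /eqP->; exists l, r.
  by rewrite !inE lb rb !orbT.
- by move=> t; rewrite !inE => ->.
Qed.

Lemma derives_gather (I : eqType) (Q : I -> tree A -> Prop) base n (s : seq I) :
  (forall x, x \in s -> exists2 T, Q x T & derives base n [:: T]) ->
  exists2 X, derives base (n * size s) X &
    forall x, x \in s -> exists2 T, T \in X & Q x T.
Proof.
elim: s => [|x s IH] H; first by exists [::] => //; exact: derives_base.
have [y ys|X dX HX] := IH; first by apply: H; rewrite inE ys orbT.
have [T QT dT] := H x (mem_head _ _).
exists (T :: X).
  rewrite mulnS; apply: (derives_trans dT); apply: (derives_sub dX) => //.
    by move=> t tb; rewrite mem_cat tb orbT.
  by move=> t tX; rewrite mem_cat tX.
move=> y; rewrite inE => /orP[/eqP->|/HX[U UX QU]].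
  by exists T; rewrite ?mem_head.
by exists U => //; rewrite inE UX orbT.
Qed.

End Derives.

(** * Joining sequences of trees at low height and linear cost *)

Lemma split_sum (I : Type) (w : I -> nat) s m n : 0 < size s ->
  \sum_(x <- s) w x <= m + n ->
  exists s1 x s2, [/\ s = s1 ++ x :: s2, \sum_(y <- s1) w y <= m &
                      \sum_(y <- s2) w y <= n].
Proof.
elim: s m => // x [|y s] IH m _.
  by move=> _; exists [::], x, [::]; rewrite !big_nil.
rewrite big_cons => H.
have [wm|wm] := leqP (w x) m.
  have [||s1 [z [s2 [-> H1 H2]]]] := IH (m - w x); [by []|by lia|].
  by exists (x :: s1), z, s2; split=> //; rewrite big_cons; lia.
by exists [::], x, (y :: s); split=> //; rewrite ?big_nil //; lia.
Qed.

Section Join.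
Variables (A : eqType) (C : Type) (b : bool).
(** A flipped [nd] with reversed yields as [ev] turns results on suffixes into results on prefixes;
    vertical nodes with [ev := grid] serve to stack rows. *)
Variables (nd : tree A -> tree A -> tree A) (ev : tree A -> seq C).
Hypothesis ndE : nd = Node b \/ nd = (fun l r => Node b r l).
Hypothesis evN : forall l r, ev (nd l r) = ev l ++ ev r.

Local Notation evs s := (flatten (map ev s)).
Local Notation derives := (derives b).

Lemma height_nd l r : height (nd l r) = (maxn (height l) (height r)).+1.
Proof. by case: ndE => -> //=; rewrite maxnC. Qed.

Lemma derives_nd base l r : l \in base -> r \in base -> derives base 1 [:: nd l r].
Proof. by move=> lb rb; case: ndE => ->; exact: derives_node. Qed.

(** The pivot of [split_sum] leaves at most half of the weight bound on either side. It is joined to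
    the left part and the result to the right part, so each halving costs two levels. *)
Lemma kraft_tree B k (s : seq (tree A * nat)) : 0 < size s ->
  (forall p, p \in s -> height p.1 <= B + 2 * p.2) ->
  \sum_(p <- s) 2 ^ p.2 <= 2 ^ k ->
  exists T, [/\ derives (map fst s) (size s).-1 [:: T],
    ev T = evs (map fst s) & height T <= B + 2 * k + 2].
Proof.
elim: k s => [|k IH] s s0 Hs Hk.
  case: s s0 Hs Hk => // p [|q s] _ Hs; last first.
    have p0 : 0 < 2 ^ p.2 by rewrite expn_gt0.
    have q0 : 0 < 2 ^ q.2 by rewrite expn_gt0.
    by rewrite !big_cons expn0; lia.
  rewrite big_seq1 leq_exp2l // => p0; exists p.1; split=> /=.
  - exact: derives_base.
  - by rewrite cats0.
  - have hp : height p.1 <= B + 2 * p.2 := Hs p (mem_head _ _).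
    by lia.
have [s1 [x [s2 [es H1 H2]]]] : exists s1 x s2, [/\ s = s1 ++ x :: s2,
   \sum_(y <- s1) 2 ^ y.2 <= 2 ^ k & \sum_(y <- s2) 2 ^ y.2 <= 2 ^ k].
  by apply: split_sum => //; move: Hk; rewrite expnS; lia.
have xk : x.2 <= k.+1.
  rewrite -(@leq_exp2l 2) //; apply: leq_trans Hk.
  by rewrite es big_cat big_cons /=; lia.
have hx : height x.1 <= B + 2 * x.2 by apply: Hs; rewrite es mem_cat mem_head orbT.
have [U [dU eU hU]] : exists U, [/\ derives (map fst s) (size s1) [:: U],
    ev U = evs (map fst (rcons s1 x)) & height U <= B + 2 * k + 3].
  have [s10|s10] := posnP (size s1).
    have -> : s1 = [::] by apply/nilP/eqP.
    exists x.1; split; last by lia.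
    - by apply: derives_base => t; rewrite inE es map_cat mem_cat /= inE => ->; rewrite orbT.
    - by rewrite /= cats0.
  have [||T [dT eT hT]] := IH s1 s10; [|exact: H1|].
    by move=> p ps; apply: Hs; rewrite es mem_cat ps.
  exists (nd T x.1); split.
  - have dT' : derives (map fst s) (size s1).-1 [:: T].
      apply: (derives_sub dT) => // t; first by rewrite es map_cat mem_cat => ->.
      by rewrite !inE => ->.
    apply: (derives_sub (derives_trans dT' (derives_nd (l := T) (r := x.1) _ _))) => //.
    + exact: mem_head.
    + by rewrite inE es map_cat mem_cat /= inE eqxx !orbT.
    + by lia.
    + by move=> t; rewrite !inE => ->; rewrite orbT.
  - by rewrite evN eT map_rcons map_rcons flatten_rcons.
  - by rewrite height_nd; lia.
have [s20|s20] := posnP (size s2).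
  have e2 : s2 = [::] by apply/nilP/eqP.
  exists U; split; last by lia.
  - apply: (derives_sub dU) => //; first by rewrite es e2 size_cat /= addn1.
    by move=> t; rewrite !inE => ->.
  - by rewrite eU es e2 cats1.
have [||T [dT eT hT]] := IH s2 s20; [|exact: H2|].
  by move=> p ps; apply: Hs; rewrite es mem_cat inE ps !orbT.
exists (nd U T); split.
- have d2 : derives (map fst s) (size s1 + (size s2).-1) [:: U; T].
    apply: (derives_trans dU (Y := [:: T])); apply: (derives_sub dT) => // t.
      by move=> ts; rewrite inE es map_cat mem_cat /= inE ts !orbT.
    by rewrite !inE => ->.
  apply: (derives_sub (derives_trans d2 (Y := [:: nd U T]) _)) => //.
  + by apply: derives_nd; rewrite !inE eqxx ?orbT.
  + by rewrite es size_cat /=; lia.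
  + by move=> t; rewrite !inE => ->; rewrite !orbT.
- by rewrite evN eU eT es -cat_rcons map_cat map_cat flatten_cat.
- by rewrite height_nd; lia.
Qed.

(* The accumulator [R] carries what lies to the right of the current half, so
   each split costs two new nodes instead of one per suffix. *)
Lemma suffixes_acc n s R h base : 0 < size s <= 2 ^ n ->
  (forall t, t \in s -> height t <= h) -> {subset s <= base} -> R \in base ->
  exists F X, [/\ derives base (3 * size s - 2) (F :: X), ev F = evs s,
    height F <= h + n &
    forall i, i < size s -> exists2 T, T \in X &
      ev T = evs (drop i s) ++ ev R /\ height T <= maxn (h + n) (height R) + n + 1].
Proof.
elim: n s R base => [|n IH] s R base.
  case: s => [|x [|y s]] // _ hs sb Rb; exists x, [:: nd x R].
  have xb : x \in base by apply: sb; exact: mem_head.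
  split=> /=.
  - apply: (derives_sub (derives_nd xb Rb)) => // t; rewrite !inE.
    by case/orP => [/eqP->|->//]; rewrite xb orbT.
  - by rewrite cats0.
  - by rewrite addn0; apply: hs; exact: mem_head.
  - case=> // _; exists (nd x R); first exact: mem_head.
    by rewrite evN /= cats0 height_nd; have := hs x (mem_head _ _); split => //; lia.
case/andP=> s0 sn hs sb Rb.
have [le|gt] := leqP (size s) (2 ^ n).
  have [|F [X [dX eF hF HX]]] := IH s R base _ hs sb Rb; first by rewrite s0.
  exists F, X; split=> //; first by lia.
  by move=> i /HX[T TX [eT hT]]; exists T => //; split=> //; lia.
have e12 := cat_take_drop (2 ^ n) s.
set s1 := take _ s in e12; set s2 := drop _ s in e12.
have z1 : size s1 = 2 ^ n by rewrite size_take gt.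
have z2 : size s2 = size s - 2 ^ n by rewrite size_drop.
have n0 : 0 < 2 ^ n by rewrite expn_gt0.
have z2n : 0 < size s2 <= 2 ^ n by rewrite z2; move: sn; rewrite expnS; lia.
have [||F2 [X2 [d2 eF2 hF2 H2]]] := IH s2 R base z2n _ _ Rb.
- by move=> t ts; apply: hs; rewrite -e12 mem_cat ts orbT.
- by move=> t ts; apply: sb; rewrite -e12 mem_cat ts orbT.
pose R1 := nd F2 R; pose Y := (F2 :: X2) ++ [:: R1].
have d3 : derives base (3 * size s2 - 2 + 1) Y.
  apply: (derives_trans d2); apply: derives_nd; rewrite mem_cat ?mem_head //.
  by rewrite Rb orbT.
have [||||F1 [X1 [d1 eF1 hF1 H1]]] := IH s1 R1 (Y ++ base).
- by rewrite z1 n0 leqnn.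
- by move=> t ts; apply: hs; rewrite -e12 mem_cat ts.
- by move=> t ts; rewrite mem_cat sb ?orbT // -e12 mem_cat ts.
- by rewrite /Y !mem_cat mem_head !orbT.
have d4 := derives_trans d3 d1.
have d5 : derives base _ _ := derives_trans d4 (derives_nd (l := F1) (r := F2) _ _).
exists (nd F1 F2), (X1 ++ X2); split.
- apply: derives_sub (d5 _ _) _ _ _ => //.
  + by rewrite !mem_cat mem_head !orbT.
  + by rewrite /Y !mem_cat mem_head.
  + by rewrite z1 z2; lia.
  + move=> t; rewrite /Y !mem_cat !inE mem_cat.
    by case/or3P => [|->|->]; rewrite ?orbT // => ->; rewrite !orbT.
- by rewrite evN eF1 eF2 -flatten_cat -map_cat e12.
- by rewrite height_nd; lia.
- have hR1 : height R1 <= (maxn (h + n) (height R)).+1 by rewrite height_nd; lia.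
  move=> i il; have [i1|i1] := ltnP i (size s1).
    have [T TX [eT hT]] := H1 i i1.
    exists T; first by rewrite mem_cat TX.
    split; last by lia.
    by rewrite eT evN eF2 catA -flatten_cat -map_cat -e12 drop_cat i1.
  have [|T TX [eT hT]] := H2 (i - size s1); first by rewrite z1 z2; lia.
  exists T; first by rewrite mem_cat TX orbT.
  split; last by lia.
  by rewrite eT -e12 drop_cat ltnNge i1.
Qed.

(** No tree has an empty yield that could start the accumulator of [suffixes_acc], so the last tree
    of [s] takes this role. *)
Lemma suffixes_log n s h : 0 < size s <= 2 ^ n ->
  (forall t, t \in s -> height t <= h) ->
  exists2 X, derives s (3 * size s) X & forall i, i < size s ->
    exists2 T, T \in X & ev T = evs (drop i s) /\ height T <= h + 2 * n + 1.
Proof.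
case/lastP: s => // s x; rewrite size_rcons => /andP[_ sn] hs.
have hx : height x <= h by apply: hs; rewrite mem_rcons mem_head.
have [X dX HX] : exists2 X, derives (rcons s x) (3 * size s) X &
    forall i, i < size s -> exists2 T, T \in X &
    ev T = evs (drop i (rcons s x)) /\ height T <= h + 2 * n + 1.
  have [s0|s0] := posnP (size s).
    by exists [::]; [exact: derives_base|move=> i; rewrite s0].
  have [||||F [X [dX _ _ HX]]] := @suffixes_acc n s x h (rcons s x).
  - by rewrite s0 ltnW.
  - by move=> t ts; apply: hs; rewrite mem_rcons inE ts orbT.
  - by move=> t ts; rewrite mem_rcons inE ts orbT.
  - by rewrite mem_rcons mem_head.
  exists X.
    apply: (derives_sub dX) => //; first by lia.
    by move=> t tX; rewrite mem_cat inE tX orbT.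
  move=> i il; have [T TX [eT hT]] := HX i il; exists T => //.
  split; last by lia.
  by rewrite eT drop_rcons 1?ltnW // map_rcons flatten_rcons.
exists (x :: X).
  apply: (derives_sub dX) => //; first by lia.
  move=> t; rewrite inE mem_cat => /orP[/eqP->|->//].
  by rewrite mem_rcons mem_head orbT.
move=> i; rewrite ltnS leq_eqVlt => /orP[/eqP->|/HX[T TX HT]]; last first.
  by exists T => //; rewrite inE TX orbT.
exists x; first exact: mem_head.
by rewrite drop_rcons // drop_size /= cats0; split=> //; lia.
Qed.

(** Balancing adds [2 * (2 * m + 2) + 1] levels, which the slack [6 * m] of light trees absorbs up
    to 5. [L] holds the whole run as one tree of weight [2 ^ (k - m)]; its height bound
    [B + 6 * (k - m) + 4 * m + 5] equals [B + 4 * k + 5 + 2 * (k - m)], the form expected by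
    [kraft_tree]. *)
Lemma light_suffixes B k m s : m <= k -> size s <= 2 ^ (2 * m + 2) ->
  (forall t, t \in s -> height t <= B + 6 * (k - m)) ->
  exists X (L : seq (tree A * nat)), [/\ derives s (3 * size s) (X ++ map fst L),
    evs (map fst L) = evs s /\ size L <= 1,
    forall p, p \in L -> height p.1 <= B + 4 * k + 5 + 2 * p.2,
    \sum_(p <- L) 2 ^ p.2 <= 2 ^ (k - m) &
    forall i, i < size s -> exists2 T, T \in X &
      ev T = evs (drop i s) /\ height T <= B + 6 * k + 5].
Proof.
move=> mk zs hs; have [s0|s0] := posnP (size s).
  have -> : s = [::] by apply/nilP/eqP.
  by exists [::], [::]; split=> //; [exact: derives_base|rewrite big_nil].
have [||X dX HX] := @suffixes_log (2 * m + 2) s (B + 6 * (k - m)).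
- by rewrite s0.
- exact: hs.
have [F FX [eF hF]] := HX 0 s0.
exists X, [:: (F, k - m)]; split.
- apply: (derives_sub dX) => // t; rewrite !mem_cat inE.
  by case/orP => [->//|/eqP->]; rewrite FX.
- by rewrite /= cats0 eF drop0.
- by move=> p; rewrite inE => /eqP-> /=; lia.
- by rewrite big_seq1.
- by move=> i /HX[T TX [eT hT]]; exists T => //; split=> //; lia.
Qed.

(* With [2 ^ (2 * m)] about [size s], there are at most [2 ^ m] heavy trees
   ([k - m < e t]), so building each suffix of the sequence of heavy trees and
   maximal light runs from scratch costs only [O(size s)]. Inside a light run a
   height overhead of [4 * m] is affordable. *)
Lemma heavy_suffixes B k m Q (e : tree A -> nat) q s : m <= k ->
  Q * 2 ^ (k - m) <= 2 ^ k -> size s <= 2 ^ (2 * m + 2) ->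
  (forall t, t \in s -> height t <= B + 6 * e t) ->
  \sum_(t <- s) 2 ^ e t <= 2 ^ k -> count (fun t => k - m < e t) s = q -> q <= Q ->
  exists X (L : seq (tree A * nat)), [/\ derives s (4 * size s + q * (2 * Q + 2)) (X ++ map fst L),
    evs (map fst L) = evs s /\ size L <= 2 * q + 1,
    forall p, p \in L -> height p.1 <= B + 4 * k + 5 + 2 * p.2,
    \sum_(p <- L) 2 ^ p.2 <= \sum_(t <- s) 2 ^ e t + q.+1 * 2 ^ (k - m) &
    forall i, i < size s -> exists2 T, T \in X &
      ev T = evs (drop i s) /\ height T <= B + 6 * k + 12].
Proof.
move=> mk Qk; set heavy := fun t => k - m < e t.
elim: q s => [|q IH] s zs hs ws cq qQ.
  have [|X [L [dX [eL sL] hL wL HX]]] := @light_suffixes B k m s mk zs.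
    move=> t ts; apply: leq_trans (hs t ts) _.
    have : ~~ heavy t.
      by apply/negP=> ht; move: cq; apply/eqP; rewrite -lt0n -has_count; apply/hasP; exists t.
    by rewrite /heavy -leqNgt; lia.
  exists X, L; split=> //.
  - apply: (derives_sub dX) => //; first by lia.
    by move=> t tX; rewrite mem_cat tX.
  - by rewrite mul1n; apply: leq_trans wL _; exact: leq_addl.
  - by move=> i /HX[T TX [eT hT]]; exists T => //; split=> //; lia.
have [s1 [x [s2 [es xh ns1]]]] :
    exists s1 x s2, [/\ s = s1 ++ x :: s2, heavy x & ~~ has heavy s1].
  have : has heavy s by rewrite has_count cq.
  by case/split_find => x s1 s2 hx ns1; exists s1, x, s2; rewrite cat_rcons.
have zE : size s = size s1 + (size s2).+1 by rewrite es size_cat.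
have wE : \sum_(t <- s) 2 ^ e t =
    \sum_(t <- s1) 2 ^ e t + (2 ^ e x + \sum_(t <- s2) 2 ^ e t).
  by rewrite es big_cat big_cons.
have [|||||X2 [L2 [d2 [eL2 sL2] hL2 wL2 HX2]]] := IH s2.
- by lia.
- by move=> t ts; apply: hs; rewrite es mem_cat inE ts !orbT.
- by lia.
- move: cq; rewrite es count_cat /= xh; move: ns1; rewrite has_count -eqn0Ngt.
  by move=> /eqP->; lia.
- by lia.
have [||X1 [L1 [d1 [eL1 sL1] hL1 wL1 HX1]]] := @light_suffixes B k m s1 mk.
- by lia.
- move=> t ts; apply: (@leq_trans (B + 6 * e t)).
    by apply: hs; rewrite es mem_cat ts.
  have : ~~ heavy t by apply: contra ns1 => ht; apply/hasP; exists t.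
  by rewrite /heavy -leqNgt; lia.
pose Lx : seq (tree A * nat) := (x, e x) :: L2.
have hLx p : p \in Lx -> height p.1 <= B + 4 * k + 5 + 2 * p.2.
  rewrite inE => /orP[/eqP->/=|]; last exact: hL2.
  have xk : e x <= k.
    by rewrite -(@leq_exp2l 2) //; apply: leq_trans ws; rewrite wE; lia.
  by have := hs x; rewrite es mem_cat mem_head orbT => /(_ isT); lia.
have kk : 2 ^ (k - m) <= 2 ^ k by rewrite leq_exp2l // leq_subr.
have qk : q.+1 * 2 ^ (k - m) <= 2 ^ k.
  by apply: leq_trans Qk; rewrite leq_mul2r qQ orbT.
(* The light runs add at most [q.+1 * 2 ^ (k - m) <= 2 ^ k] to the weight, so [Lx] weighs at most
   [2 ^ k.+1]. The tree [R] has height at most [B + 6 * k + 11], which leaves one level for a join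
   with a suffix of the run [s1]. *)
have [||R [dR eR hR]] := @kraft_tree (B + 4 * k + 5) k.+2 Lx _ hLx; first by [].
  by rewrite big_cons /= !expnS; lia.
have sub2 : {subset s2 <= s} by move=> t ts; rewrite es mem_cat inE ts !orbT.
have sub1 : {subset s1 <= s} by move=> t ts; rewrite es mem_cat ts.
have xs : x \in s by rewrite es mem_cat mem_head orbT.
pose Y2 := X2 ++ map fst L2.
have d2' : derives s (4 * size s2 + q * (2 * Q + 2)) Y2.
  by apply: (derives_sub d2) => // t tY; rewrite mem_cat tY.
have d3 : derives s (4 * size s2 + q * (2 * Q + 2) + size L2) (Y2 ++ [:: R]).
  apply: (derives_trans d2'); apply: (derives_sub dR (leqnn _)) => t.
    rewrite inE /Y2 !mem_cat => /orP[/eqP->|->]; last by rewrite orbT.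
    by rewrite xs orbT.
  by rewrite inE => /eqP->; rewrite mem_head.
pose Y3 := Y2 ++ [:: R]; rewrite -/Y3 in d3.
pose Y1 := X1 ++ map fst L1.
have d4 : derives s (4 * size s2 + q * (2 * Q + 2) + size L2 + 3 * size s1) (Y3 ++ Y1).
  apply: (derives_trans d3); apply: (derives_sub d1 (leqnn _)) => t.
    by move/sub1 => ts; rewrite mem_cat ts orbT.
  by move=> tY; rewrite mem_cat tY.
pose P i T := ev T = evs (drop i s) /\ height T <= B + 6 * k + 12.
have RE : ev R = evs (x :: s2) by rewrite eR /= eL2.
(* A suffix starting in the light run [s1] is a suffix of that run followed by [R]: one new node
   each. *)
have [|Z dZ HZ] := @derives_gather _ b _ P ((Y3 ++ Y1) ++ s) 1 (iota 0 (size s1)).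
  move=> i; rewrite mem_iota add0n => /andP[_ il].
  have [T TX [eT hT]] := HX1 i il; exists (nd T R).
    by rewrite /P evN eT RE es drop_cat il map_cat flatten_cat height_nd; split => //; lia.
  by apply: derives_nd; rewrite !mem_cat ?inE ?eqxx ?TX ?orbT.
have d5 := derives_trans d4 dZ.
exists (R :: X2 ++ Z), (L1 ++ Lx); split.
- apply: (derives_sub d5) => //.
    (* [R] costs [size L2 <= 2 * q + 1] nodes; the run [s1] costs three per tree for its own
       suffixes and one for the join with [R]. *)
    by rewrite size_iota mulSn; lia.
  move=> t; rewrite map_cat /Y3 /Y2 /Y1 /= !(inE, mem_cat).
  have [->|_] := eqVneq t x; first by rewrite xs !orbT.
  by do !case: (t \in map _ _); do !case: (t \in _); rewrite ?orbT //= ?orbF => ->.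
- split; last by rewrite size_cat /=; lia.
  by rewrite map_cat map_cat flatten_cat eL1 /= eL2 es map_cat flatten_cat.
- by move=> p; rewrite mem_cat => /orP[/hL1|/hLx].
- rewrite big_cat big_cons /= wE mulSn.
  by have := leq_add wL1 wL2; rewrite /=; lia.
move=> i il; have [i1|i1] := ltnP i (size s1).
  have [|T TZ PT] := HZ i; first by rewrite mem_iota.
  by exists T => //; rewrite inE mem_cat TZ !orbT.
have [i2|i2] := eqVneq i (size s1).
  exists R; first exact: mem_head.
  rewrite es i2 drop_size_cat // RE; split=> //.
  by lia.
have [|T TX [eT hT]] := HX2 (i - (size s1).+1); first by lia.
exists T; first by rewrite inE mem_cat TX orbT.
split=> //; rewrite eT es drop_cat ltnNge i1 /=.
by rewrite (_ : i - size s1 = (i - (size s1).+1).+1) //; lia.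
Qed.

(** Heavy trees weigh more than [2 ^ (k - m)] each and at most [2 ^ k] together, so their number [q]
    is at most [2 ^ m]. As [2 ^ (2 * m) <= size s], the extra term [q * (2 * q + 2) <= 4 * q * q] is
    at most [4 * size s]. *)
Lemma suffixes B k (e : tree A -> nat) s :
  (forall t, t \in s -> height t <= B + 6 * e t) ->
  \sum_(t <- s) 2 ^ e t <= 2 ^ k ->
  exists2 X, derives s (8 * size s) X & forall i, i < size s ->
    exists2 T, T \in X & ev T = evs (drop i s) /\ height T <= B + 6 * k + 12.
Proof.
move=> hs ws; have [s0|s0] := posnP (size s).
  by exists [::]; [exact: derives_base|rewrite s0].
pose m := (trunc_log 2 (size s))./2.
have /andP[lo hi] := trunc_log_bounds (isT : 1 < 2) s0.
have mlo : 2 ^ (2 * m) <= size s.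
  by apply: leq_trans lo; rewrite leq_exp2l // /m; lia.
have mhi : size s <= 2 ^ (2 * m + 2).
  by apply: leq_trans (ltnW hi) _; rewrite leq_exp2l // /m; lia.
have sk : size s <= 2 ^ k.
  apply: leq_trans ws; rewrite -sum1_size.
  by apply: leq_sum => t _; rewrite expn_gt0.
have mk : m <= k.
  by have := leq_trans mlo sk; rewrite leq_exp2l //; lia.
pose q := count (fun t => k - m < e t) s.
have qk : q * 2 ^ (k - m) <= 2 ^ k.
  apply: leq_trans ws; rewrite /q -sum1_count big_distrl /= big_mkcond /=.
  apply: leq_sum => t _; case: ifP => // ht.
  by rewrite mul1n leq_exp2l // ltnW.
have qm : q <= 2 ^ m.
  by rewrite -(@leq_pmul2r (2 ^ (k - m))) ?expn_gt0 // -expnD subnKC.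
have [X [L [dX _ _ _ HX]]] := heavy_suffixes mk qk mhi hs ws (erefl q) (leqnn q).
exists X; last exact: HX.
apply: (derives_sub dX) => //; last by move=> t tX; rewrite !mem_cat tX.
have : q * q <= 2 ^ m * 2 ^ m by apply: leq_mul.
rewrite -expnD addnn -mul2n; nia.
Qed.

End Join.

(** * Occurrences of subtrees *)

Section Subtrees.
Variable A : eqType.
Implicit Types (t u v : tree A) (rs : seq (tree A)).

Fixpoint subtrees t : seq (tree A) :=
  t :: match t with Leaf _ => [::] | Node _ l r => subtrees l ++ subtrees r end.

Definition child v u : bool :=
  match u with Leaf _ => false | Node _ l r => (v == l) || (v == r) end.

Lemma yield_gt0 t : 0 < size (yield t).
Proof. by elim: t => //= b l IHl r _; rewrite size_cat addn_gt0 IHl. Qed.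

Lemma child_height v u : child v u -> height v < height u.
Proof. by case: u => //= b l r /orP[] /eqP->; lia. Qed.

Lemma size_subtrees t : size (subtrees t) < 2 * size (yield t).
Proof. by elim: t => //= b l IHl r IHr; rewrite !size_cat; lia. Qed.

Lemma mem_subtrees t : t \in subtrees t.
Proof. by case: t => *; rewrite inE eqxx. Qed.

Lemma subtrees_child v u t : u \in subtrees t -> child v u -> v \in subtrees t.
Proof.
elim: t => [a|b l IHl r IHr]; rewrite /= inE; first by move/eqP->.
rewrite inE !mem_cat => /or3P[/eqP->|/IHl H /H->|/IHr H /H->]; rewrite ?orbT //=.
by case/orP => /eqP->; rewrite mem_subtrees ?orbT.
Qed.

(** Every node with child [v] accounts for an occurrence of [v] of its own, and the root may be one
    more. Equality can fail because [Node b v v] is counted once on the left. *)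
Lemma count_child v t :
  count (child v) (subtrees t) + (t == v) <= count_mem v (subtrees t).
Proof.
elim: t => [a|b l IHl r IHr] /=; first by lia.
rewrite !count_cat (eq_sym v l) (eq_sym v r).
by case: (l == v) IHl; case: (r == v) IHr; case: (_ == v) => /=; lia.
Qed.

(** Repetitions are kept, so that [count_mem v] counts the occurrences of [v] in the derivation
    forest of [rs]. *)
Definition occs rs := flatten (map subtrees rs).

Lemma occs_child rs v u : u \in occs rs -> child v u -> v \in occs rs.
Proof.
case/flatten_mapP => t ts /subtrees_child H /H vt.
by apply/flatten_mapP; exists t.
Qed.

Lemma count_child_occs rs v : count (child v) (occs rs) <= count_mem v (occs rs).
Proof.
rewrite /occs; elim: rs => //= t rs IH; rewrite !count_cat leq_add //.
by apply: leq_trans (count_child v t); exact: leq_addr.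
Qed.

End Subtrees.

(** * The potential and the chains on which it is constant *)

Lemma trunc_log2P n : 0 < n -> 2 ^ trunc_log 2 n <= n < 2 * 2 ^ trunc_log 2 n.
Proof. by move=> n0; rewrite -expnS; exact: trunc_log_bounds. Qed.

Section Potential.
Variables (A : eqType) (rs : seq (tree A)).
Implicit Types (t u v : tree A) (s : seq (tree A)).

Local Notation F := (occs rs).
Local Notation lg := (trunc_log 2).
Local Notation len t := (size (yield t)).
Local Notation mult := (fun t => count_mem t F).

(* The summand [lg (size F)] only keeps the subtraction from being truncated. *)
Definition potential t := lg (len t) + (lg (size F) - lg (mult t)).
Local Notation phi := potential.

Lemma mult_child u v : child v u -> mult u <= mult v.
Proof.
move=> vu; apply: leq_trans (count_child_occs rs v).
by apply: sub_count => w /= /eqP->.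
Qed.

Lemma len_child u v : child v u -> len v < len u.
Proof.
case: u => //= b l r; rewrite size_cat; have := yield_gt0 l; have := yield_gt0 r.
by move=> ? ? /orP[] /eqP->; lia.
Qed.

Lemma potential_child u v : child v u -> phi v <= phi u.
Proof.
move=> vu; apply: leq_add; first by apply: leq_trunc_log; exact/ltnW/len_child.
by apply: leq_sub2l; apply: leq_trunc_log; exact: mult_child.
Qed.

(** Both summands of [potential] are monotone, so a constant sum forces each to be constant. *)
Lemma potential_child_eq u v : child v u -> phi v = phi u ->
  lg (len v) = lg (len u) /\ lg (mult v) = lg (mult u).
Proof.
move=> vu; rewrite /phi.
have := leq_trunc_log 2 (ltnW (len_child vu)); have := leq_trunc_log 2 (mult_child vu).
have : lg (mult v) <= lg (size F) by apply: leq_trunc_log; exact: count_size.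
by lia.
Qed.

(** If both children kept the potential, each would have length at least [2 ^ lg (len u)], and twice
    that exceeds [len u]. Hence chains do not branch downwards. *)
Lemma potential_children b l r (u := Node b l r) : phi l = phi u -> phi r < phi u.
Proof.
move=> hl; have lu : child l u by rewrite /u /= eqxx.
have ru : child r u by rewrite /u /= eqxx orbT.
rewrite ltn_neqAle potential_child // andbT; apply/eqP => hr.
have [el _] := potential_child_eq lu hl; have [er _] := potential_child_eq ru hr.
have /andP[_] := trunc_log2P (yield_gt0 u).
have /andP[+ _] := trunc_log2P (yield_gt0 l).
have /andP[+ _] := trunc_log2P (yield_gt0 r).
by rewrite el er {3}/u /= size_cat; lia.
Qed.

(** Dual to [potential_children]: two distinct parents, each occurring at least [2 ^ lg (mult v)]
    times, would give [v] too many occurrences. Hence chains do not merge. *)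
Lemma potential_parent u u' v : u \in F -> u' \in F -> child v u -> child v u' ->
  phi u = phi v -> phi u' = phi v -> u = u'.
Proof.
move=> uF uF' vu vu' /esym h /esym h'; apply/eqP; apply/negPn/negP => ne.
have [_ e] := potential_child_eq vu h; have [_ e'] := potential_child_eq vu' h'.
have m0 : 0 < mult u by rewrite -has_count has_pred1.
have m0' : 0 < mult u' by rewrite -has_count has_pred1.
have mv : mult u + mult u' <= mult v.
  rewrite -count_predUI (@eq_count _ (predI _ _) pred0) ?count_pred0 ?addn0; last first.
    by move=> w /=; apply/negP => /andP[/eqP-> /eqP E]; case/eqP: ne.
  apply: leq_trans (count_child_occs rs v).
  by apply: sub_count => w /= /orP[] /eqP->.
have /andP[+ _] := trunc_log2P m0; have /andP[+ _] := trunc_log2P m0'.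
have /andP[_] := trunc_log2P (leq_trans m0 (mult_child vu)).
by rewrite -e -e'; lia.
Qed.

(** By [potential_children], at most one child of a node of potential [f] has potential [f], so
    testing the left child first loses nothing. *)
Fixpoint chain f t : seq (tree A) :=
  t :: match t with
       | Leaf _ => [::]
       | Node _ l r => if phi l == f then chain f l
                       else if phi r == f then chain f r else [::]
       end.

Lemma mem_chain f t : t \in chain f t.
Proof. by case: t => *; rewrite inE eqxx. Qed.

Lemma chain_parent f t v : v \in chain f t ->
  v = t \/ exists2 u, u \in chain f t & child v u.
Proof.
have aux u b l r : child u (Node b l r) -> {subset chain f u <= chain f (Node b l r)} ->
    (v \in chain f u -> v = u \/ exists2 w, w \in chain f u & child v w) ->
    v \in chain f u -> exists2 w, w \in chain f (Node b l r) & child v w.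
  move=> cu sub H /H[->|[w /sub wu vw]]; last by exists w.
  by exists (Node b l r) => //; exact: mem_chain.
elim: t => [a|b l IHl r IHr] /=; first by rewrite inE => /eqP; left.
rewrite inE => /orP[/eqP|]; first by left.
case: ifP => hl; last case: ifP => hr //.
  move/(aux l b l r); move=> H; right; have := H _ _ IHl; rewrite /= hl; apply.
    by rewrite eqxx.
  by move=> w; rewrite inE => ->; rewrite orbT.
move/(aux r b l r); move=> H; right; have := H _ _ IHr; rewrite /= hl hr; apply.
  by rewrite eqxx orbT.
by move=> w; rewrite inE => ->; rewrite orbT.
Qed.

Lemma chain_height f t v : v \in chain f t -> height v <= height t.
Proof.
elim: t => [a|b l IHl r IHr] /=; first by rewrite inE => /eqP->.
rewrite inE => /orP[/eqP->//|].
by case: ifP => _; [move/IHl; lia|case: ifP => // _ /IHr; lia].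
Qed.

Lemma chain_uniq f t : uniq (chain f t).
Proof.
elim: t => [a|b l IHl r IHr] //=; apply/andP; split; last by do !case: ifP.
apply/negP; case: ifP => _; [move/chain_height|case: ifP => // _ /chain_height] => /=;
 by lia.
Qed.

Lemma chain_sub f t v s : (forall u w, u \in s -> child w u -> w \in s) ->
  t \in s -> phi t = f -> v \in chain f t ->
  [/\ v \in s, phi v = f & lg (len v) = lg (len t)].
Proof.
move=> cs; elim: t => [a|b l IHl r IHr] ts ft; first by rewrite inE => /eqP->.
have cl : child l (Node b l r) by rewrite /= eqxx.
have cr : child r (Node b l r) by rewrite /= eqxx orbT.
rewrite inE -/chain => /orP[/eqP->//|]; case: ifP => [/eqP hl|_]; last case: ifP => [/eqP hr|//].
  case/(IHl (cs _ _ ts cl) hl) => vs fv ->; split=> //.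
  by have [->] := potential_child_eq cl (etrans hl (esym ft)).
case/(IHr (cs _ _ ts cr) hr) => vs fv ->; split=> //.
by have [->] := potential_child_eq cr (etrans hr (esym ft)).
Qed.

(** * Balancing chain by chain *)

Definition hclosed (T : seq (tree A)) := forall b l r, Node b l r \in T ->
  [/\ b = false, l \in T & r \in T].

Lemma hclosed_derives T n X : hclosed T -> derives false T n X ->
  exists T', [/\ hclosed T', size T' <= n + size T, {subset T <= T'} & {subset X <= T'}].
Proof.
move=> cT [E [sE bE sX]]; exists (E ++ T); split=> //.
- move=> b l r; rewrite mem_cat => /orP[/bE[l' [r' [[-> -> ->] ? ?]]]|/cT[-> lT rT]] //.
  by rewrite !mem_cat lT rT !orbT.
- by rewrite size_cat leq_add2r.
- by move=> t tT; rewrite mem_cat tT orbT.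
Qed.

Local Notation ryield := (fun t => rev (yield t)).
Local Notation lyields s := (flatten (map (@yield A) s)).
Local Notation ryields s := (rev (flatten (map ryield s))).

(** The bound has the form assumed by [suffixes], with exponent [lg (len t)]. *)
Definition balanced (T : seq (tree A)) B t := exists2 t', t' \in T &
  yield t' = yield t /\ height t' <= B + 6 * lg (len t).

(** [P] stands for the bottom of the chain, [Ls] and [Rs] for the trees hanging off to the left and
    to the right, both listed from the top down. Descending drops heads of these lists. As [Rs] runs
    from the right end inwards, its word is a reversed concatenation of reversed yields. *)
Lemma chain_shape T B f s t : (forall u w, u \in s -> child w u -> w \in s) ->
  (forall v, v \in s -> phi v < f -> balanced T B v) -> t \in s -> phi t = f ->
  exists P (Ls Rs : seq (tree A)), [/\
    (exists a, P = Leaf a) \/ (exists l r, [/\ P = Node false l r, l \in T & r \in T]),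
    height P <= B + 6 * lg (len t) + 1,
    forall x, x \in Ls ++ Rs -> x \in T /\ height x <= B + 6 * lg (len x),
    yield t = lyields Ls ++ yield P ++ ryields Rs /\
      size Ls + size Rs < size (chain f t) &
    forall v, v \in chain f t -> exists i j,
      yield v = lyields (drop i Ls) ++ yield P ++ ryields (drop j Rs)].
Proof.
move=> cs hT; elim: t => [a|b l IHl r IHr] ts ft.
  exists (Leaf a), [::], [::]; split=> //=; [by left; exists a|lia|].
  by move=> v; rewrite inE => /eqP->; exists 0, 0.
have cl : child l (Node b l r) by rewrite /= eqxx.
have cr : child r (Node b l r) by rewrite /= eqxx orbT.
have ls := cs _ _ ts cl; have rs' := cs _ _ ts cr.
have ll := leq_trunc_log 2 (ltnW (len_child cl)).
have lr := leq_trunc_log 2 (ltnW (len_child cr)).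
have pl := potential_child cl; have pr := potential_child cr.
rewrite [chain _ _]/=; case: ifP => [/eqP hl|/eqP hl].
  have hr : phi r < f by rewrite -ft (@potential_children b l r) // hl.
  have [P [Ls [Rs [PT hP HLR [yl zl] Hc]]]] := IHl ls hl.
  have [r' r'T [yr' hr']] := hT r rs' hr.
  exists P, Ls, (r' :: Rs); split=> //.
  - by move: ll hP; rewrite /=; lia.
  - move=> x; rewrite mem_cat inE orbCA => /orP[/eqP->|xLR]; first by rewrite yr'.
    by apply: HLR; rewrite mem_cat.
  - by rewrite /= yl rev_cat revK yr' -!catA; split=> //; lia.
  - move=> v; rewrite inE => /orP[/eqP->|/Hc[i [j e]]]; last by exists i, j.+1.
    by exists 0, 0; rewrite /= drop0 yl rev_cat revK yr' -!catA.
have hl' : phi l < f by rewrite -ft ltn_neqAle pl andbT ft; exact/eqP.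
have [l' l'T [yl' hl'']] := hT l ls hl'.
case: ifP => [/eqP hr|/eqP hr].
  have [P [Ls [Rs [PT hP HLR [yr zr] Hc]]]] := IHr rs' hr.
  exists P, (l' :: Ls), Rs; split=> //.
  - by move: lr hP; rewrite /=; lia.
  - move=> x; rewrite inE => /orP[/eqP->|]; first by rewrite yl'.
    exact: HLR.
  - by rewrite /= yr yl' -!catA; split=> //; lia.
  - move=> v; rewrite inE => /orP[/eqP->|/Hc[i [j e]]]; last by exists i.+1, j.
    by exists 0, 0; rewrite /= drop0 yr yl' -!catA.
have hr' : phi r < f by rewrite -ft ltn_neqAle pr andbT ft; exact/eqP.
have [r' r'T [yr' hr'']] := hT r rs' hr'.
exists (Node false l' r'), [::], [::]; split=> //=.
- by right; exists l', r'.
- by move: ll lr; rewrite /=; lia.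
- by rewrite yl' yr' cats0.
- by move=> v; rewrite inE => /eqP->; exists 0, 0; rewrite /= yl' yr' cats0.
Qed.

Lemma sum_lg_yields (s : seq (tree A)) :
  \sum_(t <- s) 2 ^ lg (len t) <= size (lyields s).
Proof.
rewrite size_flatten sumnE !big_map; apply: leq_sum => t _.
by have /andP[] := trunc_log2P (yield_gt0 t).
Qed.

(** The factor 11 covers 8 nodes per hanging tree, two joins per chain node, and [P]. All chain
    nodes [v] share the value [lg (len v)], so a height bound in terms of the top [t] suits each of
    them. *)
Lemma chain_derives T B f s t : (forall u w, u \in s -> child w u -> w \in s) ->
  (forall v, v \in s -> phi v < f -> balanced T B v) -> t \in s -> phi t = f ->
  hclosed T -> exists T', [/\ hclosed T', size T' <= 11 * size (chain f t) + size T,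
    {subset T <= T'} & forall v, v \in chain f t -> balanced T' (B + 20) v].
Proof.
move=> cs hT ts ft cT.
have [P [Ls [Rs [PT hP HLR [yt zt] Hc]]]] := chain_shape cs hT ts ft.
(* The rounding up to [2 ^ k >= len t] makes the bound of [suffixes] equal to
   [B + 6 * lg (len t) + 18]; the joins with [P] and with the right part bring 18 to 20. *)
pose T1 := P :: T; pose k := (lg (len t)).+1.
have cT1 : hclosed T1.
  move=> b l r; rewrite inE => /orP[/eqP|/cT[-> lT rT]]; last by rewrite !inE lT rT !orbT.
  case: PT => [[a ->]//|[l' [r' [-> lT rT]]]] [-> -> ->].
  by rewrite !inE lT rT !orbT.
have TT1 : {subset T <= T1} by move=> x xT; rewrite inE xT orbT.
have lk : len t <= 2 ^ k.
  by rewrite expnS; have /andP[_ /ltnW] := trunc_log2P (yield_gt0 t).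
have LT x : x \in Ls -> x \in T /\ height x <= B + 6 * lg (len x).
  by move=> xL; apply: HLR; rewrite mem_cat xL.
have RT x : x \in Rs -> x \in T /\ height x <= B + 6 * lg (len x).
  by move=> xL; apply: HLR; rewrite mem_cat xL orbT.
have [||||X1 d1 H1] := @suffixes _ _ false (Node false) (@yield A) _ _ B k (fun x => lg (len x)) Ls.
- by left.
- by [].
- by move=> x /LT[].
- apply: leq_trans (sum_lg_yields Ls) (leq_trans _ lk).
  by rewrite yt size_cat leq_addr.
(* Mirrored instance: suffixes of [Rs] under flipped joins are prefixes of the right-hand word. *)
have [||||X2 d2 H2] := @suffixes _ _ false (fun l r => Node false r l) ryield _ _ B k (fun x => lg (len x)) Rs.
- by right.
- by move=> l r /=; rewrite rev_cat.
- by move=> x /RT[].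
- apply: leq_trans (sum_lg_yields Rs) (leq_trans _ lk).
  rewrite yt !size_cat size_rev !size_flatten /shape -!map_comp.
  rewrite (@eq_map _ _ (size \o ryield) (size \o (@yield A))) ?addnA ?leq_addl //.
  by move=> x /=; rewrite size_rev.
have d12 : derives false T1 (8 * size Ls + 8 * size Rs) (X1 ++ X2).
  apply: (derives_trans (X := X1)).
    apply: (derives_sub d1) => // x; first by move/LT => [/TT1].
    by rewrite mem_cat => ->.
  apply: (derives_sub d2) => // x; last by rewrite mem_cat => ->.
  by case/RT => xT _; rewrite mem_cat (TT1 x xT) orbT.
pose Q v Z := yield Z = yield v /\ height Z <= B + 6 * lg (len t) + 20.
have [|X dX HX] := @derives_gather _ false _ Q ((X1 ++ X2) ++ T1) 2 (chain f t).
  move=> v /Hc[i [j yv]].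
  have [U [dU yU hU]] : exists U, [/\ derives false ((X1 ++ X2) ++ T1) 1 [:: U],
      yield U = lyields (drop i Ls) ++ yield P & height U <= B + 6 * lg (len t) + 19].
    (* An index past the end stands for the empty word; the join is then skipped. *)
    have [iL|iL] := ltnP i (size Ls).
      have [V VX [yV hV]] := H1 i iL; exists (Node false V P); split.
      - by apply: derives_node; rewrite !mem_cat ?mem_head ?VX ?orbT.
      - by rewrite /= yV.
      - by rewrite /=; move: hV hP; rewrite /k; lia.
    exists P; split; last by lia.
    - by apply: derives_base => x; rewrite inE => /eqP->; rewrite !mem_cat mem_head orbT.
    - by rewrite drop_oversize.
  have [jR|jR] := ltnP j (size Rs).
    have [V VX [yV hV]] := H2 j jR; exists (Node false U V).
      split; last by rewrite /=; move: hV hU; rewrite /k; lia.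
      by rewrite /= yv yU catA -yV revK.
    apply: (derives_sub (derives_trans dU (derives_node false (l := U) (r := V) _ _))) => //.
    + exact: mem_head.
    + by rewrite inE !mem_cat VX !orbT.
    + by move=> x; rewrite !inE => ->; rewrite orbT.
  exists U; last by apply: (derives_sub dU) => // x; rewrite mem_cat => ->.
  by split; [rewrite yU yv (drop_oversize jR) cats0|lia].
have [T' [cT' sT' sub1 sub2]] := hclosed_derives cT1 (derives_trans d12 dX).
exists T'; split=> //.
- by apply: leq_trans sT' _; rewrite /=; lia.
- by move=> x /TT1/sub1.
move=> v vc; have [Z ZX [yZ hZ]] := HX v vc.
exists Z; first by apply: sub2; rewrite mem_cat ZX orbT.
by split=> //; have [_ _ ->] := chain_sub cs ts ft vc; lia.
Qed.

Lemma exists_max (I : eqType) (g : I -> nat) (s : seq I) : 0 < size s ->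
  exists2 x, x \in s & forall y, y \in s -> g y <= g x.
Proof.
elim: s => // x [|y s] IH _.
  by exists x; [exact: mem_head|move=> z; rewrite inE => /eqP->].
have [//|z zs Hz] := IH.
have [xz|zx] := leqP (g x) (g z).
  exists z; first by rewrite inE zs orbT.
  by move=> w; rewrite inE => /orP[/eqP->//|]; exact: Hz.
exists x; first exact: mem_head.
move=> w; rewrite inE => /orP[/eqP->//|/Hz wz]; exact: leq_trans wz (ltnW zx).
Qed.

(** A chain of maximal potential [f] is removed, the rest is balanced by induction, and the chain is
    rebuilt on top. The trees hanging off it have smaller potential, hence the offset [20 * f], to
    which the chain adds 20. *)
Lemma balance_closed s : uniq s -> {subset s <= F} ->
  (forall u w, u \in s -> child w u -> w \in s) ->
  exists T, [/\ hclosed T, size T <= 11 * size s &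
    forall v, v \in s -> balanced T (20 * (phi v).+1) v].
Proof.
have [n] := ubnP (size s); elim: n s => // n IH s; rewrite ltnS => sn us sF cs.
have [s0|s0] := posnP (size s).
  have -> : s = [::] by apply/nilP/eqP.
  by exists [::].
have [x0 x0s Hx0] := exists_max phi s0.
pose f := phi x0.
(* A highest node of maximal potential is the top of its chain, which makes the complement of the
   chain closed under children. *)
have [|x xs' Hx] := @exists_max _ (@height A) [seq y <- s | phi y == f].
  by rewrite size_filter -has_count; apply/hasP; exists x0.
move: xs'; rewrite mem_filter => /andP[/eqP fx xs].
have Hf y : y \in s -> phi y <= f by exact: Hx0.
pose c := chain f x; pose s' := [seq y <- s | y \notin c].
have cP y : y \in c -> [/\ y \in s, phi y = f & lg (len y) = lg (len x)].
  exact: chain_sub.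
have zs : size c + size s' <= size s.
  rewrite /s' -(count_predC (mem c) s) -!size_filter leq_add //.
  apply: uniq_leq_size; first exact: chain_uniq.
  by move=> y yc; rewrite mem_filter /= yc; have [] := cP y yc.
have c0 : 0 < size c by rewrite /c; case: (x) => *.
have [||||T [cT zT HT]] := IH s'.
- by apply: leq_trans (leq_trans _ zs) sn; rewrite -add1n leq_add2r.
- exact: filter_uniq.
- by move=> y; rewrite mem_filter => /andP[_ /sF].
- move=> u v; rewrite !mem_filter => /andP[uc us'] vu.
  rewrite (cs _ _ us' vu) andbT; apply/negP => vc.
  (* A parent [u] outside the chain of a node [v] inside has maximal potential too. It is either a
     parent of the top [x], hence too high, or equal to the parent of [v] in the chain. *)
  have [_ fv _] := cP v vc.
  have fu : phi u = f.
    by apply/eqP; rewrite eqn_leq Hf // -fv potential_child.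
  have [e|[w wc vw]] := chain_parent vc.
    have := Hx u; rewrite mem_filter fu eqxx us' => /(_ isT).
    by rewrite leqNgt -e child_height.
  have [ws fw _] := cP w wc.
  case/negP: uc; rewrite (potential_parent (u := u) (u' := w) (v := v)) ?fu ?fw ?fv //.
    exact: sF.
  exact: sF.
have HB v : v \in s -> phi v < f -> balanced T (20 * f) v.
  move=> vs fv; have [|t tT [yt ht]] := HT v.
    rewrite mem_filter vs andbT; apply/negP => /cP[_ e _].
    by rewrite e ltnn in fv.
  by exists t => //; split=> //; lia.
have [T' [cT' zT' sub HT']] := chain_derives cs HB xs fx cT.
exists T'; split=> //.
  apply: leq_trans zT' (leq_trans (leq_add (leqnn _) zT) _).
  by rewrite -mulnDr leq_mul2l.
move=> v vs; have [vc|vc] := boolP (v \in c).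
  have [_ fv _] := cP v vc; have [t tT [yt ht]] := HT' v vc.
  by exists t => //; split=> //; rewrite fv; lia.
have [|t tT [yt ht]] := HT v; first by rewrite mem_filter vc.
by exists t => //; exact: sub.
Qed.

End Potential.

(** * From grammars to trees and back *)

Section Grammars.
Variable A : eqType.
Implicit Types (t u v : tree A) (g : slp2 A).

Lemma exps_rcons g r : exps (rcons g r) = rcons (exps g) (eval_rhs (exps g) r).
Proof. by rewrite /exps foldl_rcons. Qed.

Lemma depths_rcons g r : depths (rcons g r) = rcons (depths g) (depth_rhs (depths g) r).
Proof. by rewrite /depths foldl_rcons. Qed.

Lemma size_exps g : size (exps g) = size g.
Proof. by elim/last_ind: g => // g r IH; rewrite exps_rcons !size_rcons IH. Qed.

Lemma exps_nth g k r0 : k < size g ->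
  nth [::] (exps g) k = eval_rhs (take k (exps g)) (nth r0 g k).
Proof.
elim/last_ind: g => // g r IH; rewrite size_rcons ltnS exps_rcons !nth_rcons size_exps.
rewrite leq_eqVlt => /orP[/eqP->|kg].
  by rewrite ltnn eqxx -cats1 take_size_cat // size_exps.
by rewrite kg IH // -cats1 takel_cat // size_exps ltnW.
Qed.

Lemma wf_slp2P g r0 : reflect
  (0 < size g /\ forall k, k < size g -> wf_rule (exps g) k (nth r0 g k)) (wf_slp2 g).
Proof.
have zz : size (zip (iota 0 (size g)) g) = size g.
  by rewrite size_zip size_iota minnn.
apply: (iffP andP) => [[g0 /(all_nthP (0, r0)) H]|[g0 H]]; split=> //.
  move=> k kg; have := H k; rewrite zz => /(_ kg).
  by rewrite nth_zip ?size_iota // nth_iota.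
apply/(all_nthP (0, r0)) => k; rewrite zz => kg.
by rewrite nth_zip ?size_iota // nth_iota //; exact: H.
Qed.

(** [w2] reads the first row only, so [wf_rule] says nothing directly about the other rows; strong
    induction on the nonterminal propagates rectangularity. *)
Lemma wf_rect g k : wf_slp2 g -> k < size g ->
  let T := nth [::] (exps g) k in 0 < h2 T /\ forall row, row \in T -> size row = w2 T.
Proof.
case: g => // r0 g0; set g := r0 :: g0.
case/(wf_slp2P _ r0) => _ wfg; have [n] := ubnP k; elim: n k => // n IH k kn kg.
move: (wfg k kg); rewrite (exps_nth r0 kg).
case: (nth r0 g k) => [a _|i j /and3P[ik jk /eqP hij]|i j /and3P[ik jk /eqP wij]] /=.
- by split=> // row; rewrite inE => /eqP->.
- rewrite !nth_take //.
  have [Hi Ri] := IH i (leq_trans ik kn) (ltn_trans ik kg).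
  have [Hj Rj] := IH j (leq_trans jk kn) (ltn_trans jk kg).
  move: hij Hi Ri Rj; move: (nth [::] _ i) (nth [::] _ j) => [//|x X] [//|y Y] hij _ Ri Rj.
  have {}hij : size (x :: X) = size (y :: Y) := hij.
  split=> // row /mapP[[p q] pq ->]; rewrite /w2 /= !size_cat.
  have pX : p \in x :: X.
    by have := map_f fst pq; rewrite -/unzip1 unzip1_zip // hij.
  have qY : q \in y :: Y.
    by have := map_f snd pq; rewrite -/unzip2 unzip2_zip // hij.
  by rewrite (Ri p pX) (Rj q qY).
- rewrite !nth_take //.
  have [Hi Ri] := IH i (leq_trans ik kn) (ltn_trans ik kg).
  have [Hj Rj] := IH j (leq_trans jk kn) (ltn_trans jk kg).
  move: wij Hi Ri Rj; move: (nth [::] _ i) (nth [::] _ j) => [//|x X] Y wij _ Ri Rj.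
  split=> // row; rewrite /vcat mem_cat => /orP[/Ri//|/Rj->].
  by rewrite -wij.
Qed.

Definition rule_of (s : seq (tree A)) t : rhs A :=
  match t with
  | Leaf a => Term a
  | Node false l r => HCat (index l s) (index r s)
  | Node true l r => VCat (index l s) (index r s)
  end.

Definition ordered (s : seq (tree A)) := forall (v w : seq (tree A)) b l r,
  s = v ++ Node b l r :: w -> l \in v /\ r \in v.

Lemma index_prefix (s v w : seq (tree A)) t (B : Type) (x0 : B) (f : tree A -> B) : s = v ++ w -> t \in v ->
  index t s < size v /\ nth x0 (map f v) (index t s) = f t.
Proof.
move=> -> tv; rewrite index_cat tv index_mem; split=> //.
by rewrite (nth_map t) ?index_mem // nth_index.
Qed.

Lemma exps_rules (s v w : seq (tree A)) : ordered s -> s = v ++ w ->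
  exps (map (rule_of s) v) = map (@grid A) v /\
  depths (map (rule_of s) v) = map (@height A) v.
Proof.
move=> os; elim/last_ind: v w => // v t IH w e; rewrite cat_rcons in e.
have [IH1 IH2] := IH _ e.
rewrite !map_rcons exps_rcons depths_rcons IH1 IH2.
case: t e => [a|b l r] e //; have [lv rv] := os _ _ _ _ _ e.
have [_ gl] := index_prefix [::] (@grid A) e lv; have [_ gr] := index_prefix [::] (@grid A) e rv.
have [_ hl] := index_prefix 0 (@height A) e lv; have [_ hr] := index_prefix 0 (@height A) e rv.
by case: b e => e /=; rewrite gl gr hl hr.
Qed.

(** Sorting by height puts children before parents, and [index] turns trees into rule numbers. The
    start is the last rule, so only trees strictly lower than [t] are listed before [t]. *)
Lemma slp_of_trees (s : seq (tree A)) t : t \in s ->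
  (forall b l r, Node b l r \in s -> [/\ l \in s, r \in s &
     if b then w2 (grid l) = w2 (grid r) else h2 (grid l) = h2 (grid r)]) ->
  exists g, [/\ wf_slp2 g, exp2 g = grid t, size_slp2 g <= 2 * size s &
                depth_slp2 g = height t].
Proof.
move=> ts cs; pose le := relpre (@height A) leq.
pose s' := [seq u <- undup s | height u < height t].
pose o := rcons (sort le s') t; pose g := map (rule_of o) o.
have le_tr : transitive le by move=> y x z; exact: leq_trans.
have le_tot : total le by move=> x y; exact: leq_total.
have memo u : u \in s -> height u < height t -> u \in o.
  by move=> us hu; rewrite mem_rcons inE mem_sort mem_filter mem_undup us hu orbT.
have osub u : u \in o -> u \in s /\ height u <= height t.
  rewrite mem_rcons inE mem_sort mem_filter mem_undup.
  by case/orP => [/eqP->//|/andP[/ltnW]].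
have po : pairwise le o.
  rewrite pairwise_rcons; apply/andP; split; last first.
    by rewrite -sorted_pairwise // sort_sorted.
  by apply/allP => u; rewrite mem_sort mem_filter => /andP[/ltnW].
have oo : ordered o.
  move=> v w b l r e.
  have xo : Node b l r \in o by rewrite e mem_cat mem_head orbT.
  have [xs xt] := osub _ xo; have [ls rs _] := cs _ _ _ xs.
  have aux u : u \in s -> height u < height (Node b l r) -> u \in v.
    move=> us hu; have := memo u us (leq_trans hu xt); rewrite e mem_cat.
    case/orP => // uw; move: po; rewrite e pairwise_cat => /and3P[_ _ /= /andP[/allP H _]].
    move: uw; rewrite inE => /orP[/eqP ux|/H]; first by rewrite ux ltnn in hu.
    by rewrite /le /= leqNgt hu.
  by split; apply: aux => //=; lia.
have [eE dE] := exps_rules (w := [::]) oo (esym (cats0 o)).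
have zo : size o <= size s.
  rewrite size_rcons size_sort size_filter.
  apply: leq_trans (size_undup s); rewrite -(count_predC (fun u => height u < height t)).
  rewrite -addn1 leq_add2l -has_count; apply/hasP; exists t; rewrite ?mem_undup //=.
  by rewrite ltnn.
exists g; split.
- case eo: o => [|x0 o']; first by move: (size_rcons (sort le s') t); rewrite -/o eo.
  apply/(wf_slp2P _ (rule_of o x0)); rewrite {1 2}/g !size_map; split; first by rewrite eo.
  move=> k ko; rewrite (nth_map x0) // /g eE.
  have eo2 : o = take k o ++ nth x0 o k :: drop k.+1 o.
    by rewrite -drop_nth // cat_take_drop.
  have xs : nth x0 o k \in s by have [] := osub _ (mem_nth x0 ko).
  case ex: (nth x0 o k) xs => [a|b l r] // xs; rewrite ex in eo2.
  have [lv rv] := oo _ _ _ _ _ eo2; have [ls rs hlr] := cs _ _ _ xs.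
  have [il _] := index_prefix [::] (@grid A) eo2 lv.
  have [ir _] := index_prefix [::] (@grid A) eo2 rv.
  have lo : l \in o by rewrite eo2 mem_cat lv.
  have ro : r \in o by rewrite eo2 mem_cat rv.
  have [_ gl] := index_prefix [::] (@grid A) (esym (cats0 o)) lo.
  have [_ gr] := index_prefix [::] (@grid A) (esym (cats0 o)) ro.
  have zk : size (take k o) = k by rewrite size_takel // ltnW.
  rewrite zk in il ir.
  by case: b hlr {ex eo2 xs} => hlr /=; rewrite il ir gl gr hlr /=.
- by rewrite /exp2 /g eE map_rcons last_rcons.
- apply: (@leq_trans (2 * size o)); last by rewrite leq_mul2l.
  rewrite /size_slp2 /g; elim: (o) (rule_of o) => //= x l IH f.
  by have := IH f; case: (f x) => *; rewrite /=; lia.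
- by rewrite /depth_slp2 /g dE map_rcons last_rcons.
Qed.

(** A nonterminal becomes one horizontal tree per row. A horizontal rule creates one node per row, a
    vertical rule creates none. *)
Definition row_rule (R : seq (seq (tree A))) (r : rhs A) : seq (tree A) :=
  match r with
  | Term a => [:: Leaf a]
  | HCat i j => [seq Node false p.1 p.2 | p <- zip (nth [::] R i) (nth [::] R j)]
  | VCat i j => nth [::] R i ++ nth [::] R j
  end.

Definition rows g := foldl (fun R r => rcons R (row_rule R r)) [::] g.

Lemma rows_rcons g r : rows (rcons g r) = rcons (rows g) (row_rule (rows g) r).
Proof. by rewrite /rows foldl_rcons. Qed.

Lemma rows_exps g : map (map (@yield A)) (rows g) = exps g.
Proof.
elim/last_ind: g => // g r IH; rewrite rows_rcons exps_rcons map_rcons -IH.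
have nE i : nth [::] (map (map (@yield A)) (rows g)) i = map (@yield A) (nth [::] (rows g) i).
  have [ir|ir] := ltnP i (size (rows g)); first by rewrite (nth_map [::]).
  by rewrite !nth_default ?size_map.
case: r => [a|i j|i j] //=; rewrite !nE /vcat ?map_cat //; congr rcons.
move: (nth _ _ i) (nth _ _ j) => X Y.
by elim: X Y => [|x X IHX] [|y Y] //=; rewrite /hcat /= IHX.
Qed.

Lemma mem_take_zip (B C : eqType) n (X : seq B) (Y : seq C) p :
  p \in take n (zip X Y) -> p.1 \in take n X /\ p.2 \in take n Y.
Proof.
elim: n X Y => [|n IH] [|x X] [|y Y] //=; rewrite !inE => /orP[/eqP->|/IH[h1 h2]] /=.
  by rewrite !eqxx.
by rewrite h1 h2 !orbT.
Qed.

(* Unreachable nonterminals may be higher than [n], hence the truncation to [n] rows. *)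
Lemma rows_closed n g : 0 < n -> exists D, [/\ size D <= size g * n,
  forall u v, u \in D -> child v u -> v \in D &
  forall i, {subset take n (nth [::] (rows g) i) <= D}].
Proof.
move=> n0; elim/last_ind: g => [|g r [D [zD cD HD]]].
  by exists [::]; split=> // i; rewrite nth_nil.
pose R := take n (row_rule (rows g) r).
exists (R ++ D); split.
- by rewrite size_cat size_rcons mulSn leq_add // size_take geq_minl.
- move=> u v; rewrite !mem_cat => /orP[uR vu|uD /(cD _ _ uD) ->]; last by rewrite orbT.
  apply/orP; right; move: uR; rewrite /R; case: (r) => [a|i j|i j] /=.
  + by case: (n) => //= n'; rewrite inE => /eqP ua; rewrite ua in vu.
  + rewrite -map_take => /mapP[p /mem_take_zip[/HD pi /HD pj] up].
    by move: vu; rewrite up /= => /orP[] /eqP->.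
  + rewrite take_cat; case: ifP => [_ /HD uD|nle]; first exact: cD vu.
    rewrite mem_cat => /orP[uX|uY]; apply: cD vu.
      by apply: (HD i); rewrite take_oversize // leqNgt nle.
    apply: (HD j); move: uY; move: (nth _ _ j) (size _) => Y k.
    have -> : take (n - k) Y = take (n - k) (take n Y).
      by rewrite take_takel // leq_subr.
    exact: mem_take.
- move=> i t; rewrite rows_rcons nth_rcons mem_cat.
  case: ifP => _; first by move/HD => ->; rewrite orbT.
  by case: ifP => _ //; rewrite -/R => ->.
Qed.

End Grammars.

(** * The final grammar *)

Lemma grid_row (A : eqType) (T : seq (tree A)) t : hclosed T -> t \in T ->
  grid t = [:: yield t].
Proof.
move=> cT; elim: t => // b l IHl r IHr /cT[-> /IHl el /IHr er].
by rewrite /= el er.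
Qed.

Theorem theorem1 :
  exists c : nat, 0 < c /\
  forall (Sigma : finType) (g : slp2 Sigma),
    wf_slp2 g ->
    let T := exp2 g in
    let N := h2 T in
    let M := w2 T in
    N <= M ->
    exists g'' : slp2 Sigma,
      [/\ wf_slp2 g'',
          exp2 g'' = T,
          size_slp2 g'' <= c * size_slp2 g * N
        & 2 <= M -> depth_slp2 g'' <= c * trunc_log 2 M].
Proof.
(* The depth is at most [H + 2 * x.+1 + 2 = 68 * x + 64], and [x >= 1] if [2 <= M]; the size is at
   most [2 * (1 + 11)] times [|G| N]. *)
exists 132; split=> // Sigma g wfg T N M NM.
have g0 : 0 < size g by case/andP: wfg.
have eT : T = nth [::] (exps g) (size g).-1 by rewrite /T /exp2 -nth_last size_exps.
have [|N0 rect] := @wf_rect _ _ (size g).-1 wfg; first by rewrite ltn_predL.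
rewrite -eT -/N -/M in N0 rect.
pose rs := nth [::] (rows g) (size g).-1.
have ers : map (@yield Sigma) rs = T.
  rewrite eT -rows_exps (nth_map [::]) //.
  by rewrite -(size_map (map (@yield Sigma))) rows_exps size_exps ltn_predL.
have zrs : size rs = N by rewrite -(size_map (@yield Sigma)) ers.
have lenrs t : t \in rs -> size (yield t) = M.
  by move=> tr; apply: rect; rewrite -ers map_f.
have [D [zD cD HD]] := rows_closed g N0.
have rsD : {subset rs <= D}.
  by move=> t tr; apply: (HD (size g).-1); rewrite -/rs take_oversize ?zrs.
pose s := undup (occs rs).
have sD : {subset s <= D}.
  move=> t; rewrite mem_undup => /flatten_mapP[u /rsD uD].
  elim: u uD => [a|b l IHl r IHr] uD; first by rewrite inE => /eqP->.
  rewrite /= inE mem_cat => /or3P[/eqP->//|/IHl|/IHr]; apply.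
    by apply: cD uD _; rewrite /= eqxx.
  by apply: cD uD _; rewrite /= eqxx orbT.
have zs : size s <= size g * N.
  by apply: leq_trans zD; apply: uniq_leq_size => //; exact: undup_uniq.
have [||Tb [cTb zTb HTb]] := @balance_closed _ rs s (undup_uniq _).
- by move=> t; rewrite mem_undup.
- by move=> u w; rewrite !mem_undup; exact: occs_child.
(* The potential is at most [x + (2 * x + 2)], so [balance_closed] gives height at most
   [20 * (3 * x + 3) + 6 * x = H]. *)
pose x := trunc_log 2 M; pose H := 66 * x + 60.
have M0 : 0 < M := leq_trans N0 NM.
have zF : size (occs rs) <= 2 * (N * M).
  rewrite -zrs /occs; elim: (rs) lenrs => //= t l IH Hl.
  have := size_subtrees t; rewrite Hl ?mem_head // => /ltnW st.
  have IHl : size (flatten (map (@subtrees Sigma) l)) <= 2 * (size l * M).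
    by apply: IH => u ul; apply: Hl; rewrite inE ul orbT.
  by rewrite size_cat (mulSn (size l)) (mulnDr 2 M) leq_add.
have KF : trunc_log 2 (size (occs rs)) <= 2 * x + 2.
  have [->|F0] := posnP (size (occs rs)); first by rewrite trunc_log0.
  have /andP[lo _] := trunc_log2P F0; have /andP[_ hi] := trunc_log2P M0.
  rewrite -ltnS -(@ltn_exp2l 2) //; apply: leq_ltn_trans (leq_trans lo zF) _.
  have -> : 2 ^ (2 * x + 2).+1 = 2 * (2 ^ x.+1 * 2 ^ x.+1).
    by rewrite -expnD expnS; congr (_ * 2 ^ _); lia.
  by rewrite ltn_pmul2l // ltn_mul // expnS // (leq_ltn_trans NM).
have [vs [vsT evs hvs]] : exists vs, [/\ {subset vs <= Tb}, map (@yield Sigma) vs = T &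
    forall v, v \in vs -> height v <= H].
  have : forall t, t \in rs -> exists2 t', t' \in Tb & yield t' = yield t /\ height t' <= H.
    move=> t tr; have [|t' t'T [yt ht]] := HTb t.
      by rewrite mem_undup; apply/flatten_mapP; exists t => //; exact: mem_subtrees.
    exists t' => //; split=> //; move: ht; rewrite /potential (lenrs t tr) -/x /H.
    by have := leq_subr (trunc_log 2 (count_mem t (occs rs))) (trunc_log 2 (size (occs rs))); lia.
  rewrite -ers; elim: (rs) => [|t l IH] Hl; first by exists [::].
  have [|vs [h1 h2 h3]] := IH; first by move=> u ul; apply: Hl; rewrite inE ul orbT.
  have [v vT [yv hv]] := Hl t (mem_head _ _).
  exists (v :: vs); split.
  - by move=> u; rewrite inE => /orP[/eqP->//|/h1].
  - by rewrite /= yv h2.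
  - by move=> u; rewrite inE => /orP[/eqP->//|/h3].
have zvs : size vs = N by rewrite -(size_map (@yield Sigma)) evs.
have gvs v : v \in vs -> grid v = [:: yield v] by move/vsT; exact: grid_row.
(* The rows are stacked with unit weights; [N <= M <= 2 ^ x.+1] keeps the vertical part logarithmic
   in [M]. *)
have [|||||V [[E [zE bE VE]] gV hV]] := @kraft_tree _ _ true (Node true) (@grid Sigma) _ _
    H x.+1 [seq (v, 0) | v <- vs].
- by left.
- by [].
- by rewrite size_map zvs.
- by move=> p /mapP[v /hvs hv ->]; rewrite /= addn0.
- rewrite big_map /= sum1_size zvs; apply: leq_trans NM _.
  by have /andP[_ /ltnW] := trunc_log2P M0; rewrite expnS.
have e0 : map fst [seq (v, 0) | v <- vs] = vs by rewrite -map_comp map_id.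
rewrite e0 in bE VE gV; rewrite size_map in zE.
have {}VE : V \in E ++ vs by apply: VE; exact: mem_head.
have {}gV : grid V = T.
  rewrite gV -evs; elim: (vs) gvs => //= v l IH Hl.
  by rewrite Hl ?mem_head // IH // => u ul; apply: Hl; rewrite inE ul orbT.
have wvs v : v \in vs -> 0 < h2 (grid v) /\ w2 (grid v) = M.
  move=> vv; rewrite (gvs _ vv); split=> //; apply: rect.
  by rewrite -evs (map_f (@yield Sigma) vv).
(* Vertical rules must join equal widths; positive heights ensure that [w2] of a stack reads a row
   of its upper part. *)
have wE t : t \in E ++ vs -> 0 < h2 (grid t) /\ w2 (grid t) = M.
  elim: t => [a|b l IHl r _]; rewrite mem_cat => /orP[/bE[l' [r' []]]|/wvs] //.
  case=> -> <- <- /IHl[hl wl] _; rewrite /= /vcat /h2 size_cat; split.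
    by rewrite addn_gt0 hl.
  by rewrite -wl; move: hl; case: (grid l).
have sub t : t \in E ++ vs -> t \in E ++ Tb.
  by rewrite !mem_cat => /orP[->//|/vsT->]; rewrite orbT.
have [|g'' [w1 w2' w3 w4]] := @slp_of_trees _ (E ++ Tb) V (sub _ VE).
  move=> b l r; rewrite mem_cat => /orP[/bE[l' [r' [[-> -> ->] lE rE]]]|/cTb[-> lT rT]].
    by rewrite !sub //; split=> //; rewrite (wE _ lE).2 (wE _ rE).2.
  by rewrite !mem_cat lT rT !orbT (grid_row cTb lT) (grid_row cTb rT).
exists g''; split=> //; first by rewrite w2'.
- have sg : size g <= size_slp2 g.
    by rewrite /size_slp2; elim: (g) => //= r l IH; case: r => *; rewrite /=; lia.
  apply: leq_trans w3 _; rewrite size_cat.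
  have : size g * N <= size_slp2 g * N by rewrite leq_mul2r sg orbT.
  have gN : N <= size g * N by rewrite leq_pmull.
  have EN : size E <= N by apply: leq_trans zE _; rewrite zvs leq_pred.
  have TN : size Tb <= 11 * (size g * N) by apply: leq_trans zTb _; rewrite leq_mul2l.
  by rewrite -mulnA; lia.
- move=> M2; rewrite w4; apply: leq_trans hV _.
  have x1 : 0 < x by rewrite trunc_log_gt0.
  by rewrite /H; lia.
Qed.
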